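(* Let $d\ge1$ be an integer and $s>0$. Let $\{X_n\}_{n\ge1}$ be IID random variables with distribution $\mu$, for some Borel probability measure $\mu$ on $\mathbb{R}^d$. Let $P_n=\{X_1,\dots,X_n\}$ and define the random variables $U_n=J_s(P_n)$ for $n\ge2$. Then: (1) if $I_s(\mu)<\infty$, then $U_n\to I_s(\mu)$ almost surely; and (2) if $I_s(\mu)=\infty$, then $U_n\to\infty$ almost surely.
   Context: For the random points, $J_s(P_n)=\frac{1}{n(n-1)}\sum_{1\le j,k\le n,\ j\ne k}|X_j-X_k|^{-s}$ (Euclidean norm), a random variable with values in $[0,+\infty]$, with the convention $|0|^{-s}=+\infty$. The Riesz $s$-energy is $I_s(\mu)=\int_{\mathbb{R}^d}\int_{\mathbb{R}^d}|x-y|^{-s}\,d\mu(y)\,d\mu(x)\in[0,+\infty]$, with the same convention. *)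

(* Defs.v *)
From HB Require Import structures.
From mathcomp Require Import all_boot all_order all_algebra finmap.
From mathcomp Require Import all_classical all_reals all_analysis.

Set Implicit Arguments.
Unset Strict Implicit.
Unset Printing Implicit Defensive.

Import Order.TTheory GRing.Theory Num.Theory.
Import numFieldNormedType.Exports.

Local Open Scope classical_set_scope.
Local Open Scope ring_scope.

(* The points of R^d with the sigma-algebra generated by the open sets. *)
Notation borelRd R d := (g_sigma_algebraType (@open 'rV[R]_d)).

(* The library norm on 'rV[R]_d is the sup norm, hence this definition. *)
Definition enorm (R : realType) (d : nat) (x : 'rV[R]_d) : R :=
  Num.sqrt (\sum_(i < d) x ord0 i ^+ 2).

(* The conditional is needed because powR gives 0 `^ (- s) = 0 in R. *)
Definition riesz_kernel (R : realType) (d : nat) (s : R) (x y : 'rV[R]_d) :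
    \bar R :=
  if enorm (x - y) == 0 then +oo%E else (enorm (x - y) `^ (- s))%:E.

Definition riesz_energy (R : realType) (d : nat) (s : R)
    (mu : probability (borelRd R d) R) : \bar R :=
  (\int[mu]_x \int[mu]_y riesz_kernel s x y)%E.

(* The points form a family rather than a set: coincident points at different
   indices contribute +oo. *)
Definition discrete_riesz_energy (R : realType) (d : nat) (s : R) (n : nat)
    (x : 'I_n -> 'rV[R]_d) : \bar R :=
  ((((n * n.-1)%:R)^-1)%:E *
    \sum_(j < n) \sum_(k < n | j != k) riesz_kernel s (x j) (x k))%E.

Definition mutually_independent (dO dT : measure_display)
    (Omega : measurableType dO) (T : measurableType dT) (R : realType)
    (P : probability Omega R) (I : choiceType) (X : I -> {RV P >-> T}) : Prop :=
  forall (J : {fset I}) (A : I -> set T),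
    (forall i, i \in J -> measurable (A i)) ->
    P (\bigcap_(i in [set` J]) (X i @^-1` A i)) =
      (\prod_(i <- J) P (X i @^-1` A i))%E.

Definition iid_with_law (dO dT : measure_display)
    (Omega : measurableType dO) (T : measurableType dT) (R : realType)
    (P : probability Omega R) (X : nat -> {RV P >-> T})
    (mu : probability T R) : Prop :=
  mutually_independent X /\
  forall (n : nat) (A : set T), measurable A -> distribution P (X n) A = mu A.

(* Main.v *)
Require Import Defs.
From HB Require Import structures.
From mathcomp Require Import all_boot all_order all_algebra finmap.
From mathcomp Require Import all_classical all_reals all_analysis.
From mathcomp Require Import measurable_realfun.
From mathcomp Require Import zify ring lra.

Set Implicit Arguments.
Unset Strict Implicit.
Unset Printing Implicit Defensive.

Import Order.TTheory GRing.Theory Num.Theory.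
Import numFieldNormedType.Exports.

Local Open Scope classical_set_scope.
Local Open Scope ring_scope.

(** The discrete energy is the U-statistic of order two with kernel
    h (x, y) = |x - y|^(-s), and the theorem is the strong law of large numbers
    for U-statistics, valid for every measurable kernel with values in
    [0, +oo] on any measurable space and without integrability assumption
    ([strong_law_ustat]): the averages converge almost surely to the double
    integral of h, be it finite or not.

    Truncate: h = min (h, M) + r_M. The kernel min (h, M) is bounded, and for
    bounded kernels the law holds by a second moment argument
    ([strong_law_bounded]): two disjoint pairs of sample points are
    independent, hence among the n^4 covariances at most 4 n^3 do not vanish,
    the variance of the average is O(1/n) and is summable along n = m^2; the
    gaps between consecutive squares are filled by monotonicity of the
    unnormalised sums. Since min (h, M) <= h and the energy of min (h, M)
    increases to that of h, this already gives the lower bound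
    liminf U_n >= I(h), and with it the case of infinite energy.

    For the upper bound, with I(h) finite, the remainder r_M has energy tending
    to 0, and what is needed is a bound on all its averages at once. It is the
    maximal inequality P (sup_n U_n(r) > l) <= I(r) / l ([ustat_maximal]).
    That inequality is the one of reversed martingales, obtained here directly
    from exchangeability: let n be the last index up to N with U_n > l. The
    event that n takes a given value is invariant under permutations of the
    first n points, so on it every pair of distinct points among these
    contributes the same integral, and the integral of U_n over the event is
    the integral of r (X_0, X_1). Summing over n costs nothing because the
    events are disjoint. *)

(** * Joint laws of finite samples *)

Section tuple_laws.
Local Open Scope ereal_scope.
Context {dT : measure_display} {T : measurableType dT} {R : realType}.

Lemma measurable_kernel dS dU (S : measurableType dS) (U : measurableType dU)
    (h : T -> T -> U) (f g : S -> T) :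
  measurable_fun setT (fun z : T * T => h z.1 z.2) ->
  measurable_fun setT f -> measurable_fun setT g ->
  measurable_fun setT (fun s => h (f s) (g s)).
Proof.
move=> mh mf mg.
exact: (measurableT_comp mh (measurable_fun_pair mf mg)).
Qed.

Definition box n (A : 'I_n -> set T) : set (n.-tuple T) :=
  [set t | forall i, A i (tnth t i)].

Lemma measurable_box n (A : 'I_n -> set T) :
  (forall i, measurable (A i)) -> measurable (box A).
Proof.
move=> mA; rewrite (_ : box A = \bigcap_(i in [set: 'I_n])
  ((fun t => tnth t i) @^-1` A i)); last first.
  by apply/seteqP; split => t tA i; [move=> _; exact: tA | exact: (tA i I)].
apply: fin_bigcap_measurable => // i _; rewrite -[X in measurable X]setTI.
exact: measurable_tnth.
Qed.

(** Boxes are stable under intersection and generate the product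
    sigma-algebra, so the pi-lambda theorem applies. *)
Lemma measure_tuple_unique n (m1 m2 : {measure set (n.-tuple T) -> \bar R}) :
  m1 setT < +oo ->
  (forall A : 'I_n -> set T, (forall i, measurable (A i)) ->
     m1 (box A) = m2 (box A)) ->
  forall B, measurable B -> m1 B = m2 B.
Proof.
move=> m1T m12 B mB.
pose G := [set C | exists2 A : 'I_n -> set T,
  (forall i, measurable (A i)) & C = box A].
have boxT : box (fun _ : 'I_n => setT) = setT by apply/seteqP; split.
apply: (measure_unique G (fun=> setT)) => //.
- rewrite /measurable/= /g_sigma_preimage; apply/seteqP; split.
    apply: smallest_sub; first exact: smallest_sigma_algebra.
    move=> C; rewrite -bigcup_seq => -[i _ [A mA <-]].
    apply: sub_sigma_algebra.
    exists (fun j => if j == i then A else setT).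
      by move=> j; case: ifP.
    rewrite setTI; apply/seteqP; split => t /= tA.
      by move=> j; case: ifPn => // /eqP ->.
    by have := tA i; rewrite eqxx.
  apply: smallest_sub; first exact: sigma_algebra_measurable.
  by move=> _ [A mA ->]; exact: measurable_box.
- move=> _ _ [A mA ->] [A' mA' ->]; exists (fun i => A i `&` A' i).
    by move=> i; exact: measurableI.
  apply/seteqP; split => [t [tA tA'] i|t tAA']; first by split.
  by split => i; have [] := tAA' i.
- by move=> _; exists (fun=> setT).
- by rewrite bigcup_const.
- by move=> _ [A mA ->]; exact: m12.
Qed.

Context {dO : measure_display} {Omega : measurableType dO}
  {P : probability Omega R} (mu : probability T R)
  (X : nat -> {RV P >-> T}).

Definition sample n (f : 'I_n -> nat) (w : Omega) : n.-tuple T :=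
  [tuple X (f i) w | i < n].

Lemma measurable_sample n (f : 'I_n -> nat) : measurable_fun setT (sample f).
Proof.
apply/measurable_fun_tnthP => i.
rewrite (_ : _ \o _ = X (f i)); first exact: measurable_funP.
by apply/funext => w /=; rewrite tnth_mktuple.
Qed.

HB.instance Definition _ n (f : 'I_n -> nat) :=
  isMeasurableFun.Build _ _ _ _ (sample f) (measurable_sample f).

Hypothesis X_iid : iid_with_law X mu.

(** For an injective choice of indices, the joint law of the sample is the
    product of copies of mu; the indices themselves do not matter. *)
Lemma sample_box n (f : 'I_n -> nat) (A : 'I_n -> set T) :
  injective f -> (forall i, measurable (A i)) ->
  P (sample f @^-1` box A) = \prod_(i < n) mu (A i).
Proof.
move=> finj mA; have [indep lawX] := X_iid.
pose J := [fset f i | i in 'I_n]%fset.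
(* B transports A along f, which is possible because f is injective. *)
pose B k := if [pick i | f i == k] is Some i then A i else setT.
have Bf i : B (f i) = A i.
  rewrite /B; case: pickP => [j /eqP/finj ->//|/(_ i)]; by rewrite eqxx.
have mB k : k \in J -> measurable (B k).
  by move=> _; rewrite /B; case: pickP.
rewrite (_ : _ @^-1` _ = \bigcap_(k in [set` J]) (X k @^-1` B k)); last first.
  apply/seteqP; split => w /=.
    by move=> wA _ /imfsetP[i _ ->]; rewrite /= Bf; have := wA i;
      rewrite tnth_mktuple.
  move=> wB i; rewrite tnth_mktuple -Bf.
  by apply: wB; apply/imfsetP; exists i.
rewrite (indep J B mB) big_imfset/=; last by move=> i j _ _; exact: finj.
rewrite big_enum; apply: eq_bigr => i _; rewrite Bf.
exact: (lawX (f i) (A i) (mA i)).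
Qed.

Lemma sample_law n (f g : 'I_n -> nat) B : injective f -> injective g ->
  measurable B -> distribution P (sample f) B = distribution P (sample g) B.
Proof.
move=> fi gi; apply: measure_tuple_unique.
  by rewrite (le_lt_trans (probability_le1 _ _)) ?ltry.
by move=> A mA; exact: (etrans (sample_box fi mA) (esym (sample_box gi mA))).
Qed.

Lemma integral_sample n (f g : 'I_n -> nat) (F : n.-tuple T -> \bar R) :
  injective f -> injective g ->
  measurable_fun setT F -> (forall t, 0 <= F t) ->
  \int[P]_w F (sample f w) = \int[P]_w F (sample g w).
Proof.
move=> fi gi mF F0.
rewrite -(ge0_integral_distribution (sample f : {RV P >-> _})) //.
rewrite -(ge0_integral_distribution (sample g : {RV P >-> _})) //.
by apply: eq_measure_integral => B mB _; exact: sample_law.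
Qed.

(* Four independent points are two independent pairs: both descriptions give
   the same measure on boxes of 4-tuples. *)
Let mu2 : probability (T * T)%type R := (mu \x mu)%E.

Let quad (z : (T * T) * (T * T)) : 4.-tuple T :=
  [tuple z.1.1; z.1.2; z.2.1; z.2.2].

Let mquad : measurable_fun setT quad.
Proof.
apply/measurable_fun_tnthP => i.
rewrite (_ : _ \o _ =
  fun z => nth z.1.1 [:: z.1.1; z.1.2; z.2.1; z.2.2] i); last first.
  by apply/funext => z; rewrite /= (tnth_nth z.1.1).
have m1 := @measurable_fst _ _ (T * T)%type (T * T)%type.
have m2 := @measurable_snd _ _ (T * T)%type (T * T)%type.
case: i => [[|[|[|[|//]]]] ?] /=.
- exact: (measurableT_comp measurable_fst m1).
- exact: (measurableT_comp measurable_snd m1).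
- exact: (measurableT_comp measurable_fst m2).
- exact: (measurableT_comp measurable_snd m2).
Qed.

HB.instance Definition _ := isMeasurableFun.Build _ _ _ _ quad mquad.

Let quad_law (f : 'I_4 -> nat) B : injective f -> measurable B ->
  distribution P (sample f) B = distribution (mu2 \x mu2) quad B.
Proof.
move=> fi; apply: measure_tuple_unique.
  by rewrite (le_lt_trans (probability_le1 _ _)) ?ltry.
move=> A mA; apply: (etrans (sample_box fi mA)).
pose i_ k : 'I_4 := inord k.
have i_E : (i_ 0%N = ord0) * (i_ 1%N = lift ord0 ord0) *
    (i_ 2%N = lift ord0 (lift ord0 ord0)) * (i_ 3%N = ord_max).
  by do 3? split; apply/val_inj; rewrite /= inordK.
transitivity ((mu2 \x mu2)
  ((A (i_ 0%N) `*` A (i_ 1%N)) `*` (A (i_ 2%N) `*` A (i_ 3%N))))%E; last first.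
  congr (_ _); apply/seteqP; split => [[[a b] [c e]] /= [[Aa Ab] [Ac Ae]] i|].
    rewrite (tnth_nth a) /quad/=; case: i => [[|[|[|[|//]]]] ?] /=.
    - by congr (A _ a) : Aa; apply/val_inj; rewrite /= inordK.
    - by congr (A _ b) : Ab; apply/val_inj; rewrite /= inordK.
    - by congr (A _ c) : Ac; apply/val_inj; rewrite /= inordK.
    - by congr (A _ e) : Ae; apply/val_inj; rewrite /= inordK.
  move=> [[a b] [c e]] /= Aq.
  have {}Aq k : A (i_ k) (nth a [:: a; b; c; e] (i_ k)).
    by have := Aq (i_ k); rewrite (tnth_nth a).
  by split; split;
    [move: (Aq 0%N)|move: (Aq 1%N)|move: (Aq 2%N)|move: (Aq 3%N)];
    rewrite inordK.
transitivity (mu (A (i_ 0%N)) * mu (A (i_ 1%N)) *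
    (mu (A (i_ 2%N)) * mu (A (i_ 3%N)))); last first.
  apply/esym; apply: (etrans (product_measure1E _ _ _ _)).
  - exact: measurableX.
  - exact: measurableX.
  - by congr (_ * _); apply: product_measure1E.
rewrite !i_E big_ord_recl big_ord_recl big_ord_recl.
rewrite big_ord_recl big_ord0/= mule1 -!muleA.
by do 3 congr (_ * _); congr (mu (A _)); apply/val_inj.
Qed.

Definition energy (h : T -> T -> \bar R) : \bar R :=
  \int[mu]_x \int[mu]_y h x y.

Lemma integral_disjoint_pairs (h g : T -> T -> \bar R) (i j k l : nat) :
  uniq [:: i; j; k; l] ->
  measurable_fun setT (fun z : T * T => h z.1 z.2) ->
  measurable_fun setT (fun z : T * T => g z.1 z.2) ->
  (forall x y, 0 <= h x y) -> (forall x y, 0 <= g x y) ->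
  \int[P]_w (h (X i w) (X j w) * g (X k w) (X l w)) = energy h * energy g.
Proof.
move=> uijkl mh mg h0 g0.
pose f (a : 'I_4) := nth O [:: i; j; k; l] a.
have fi : injective f.
  move=> a b /eqP; rewrite nth_uniq// => /eqP; exact: val_inj.
pose F (t : 4.-tuple T) := h (tnth t (inord 0)) (tnth t (inord 1)) *
  g (tnth t (inord 2)) (tnth t (inord 3)).
have mF : measurable_fun setT F.
  apply: emeasurable_funM.
    by apply: (measurable_kernel mh); exact: measurable_tnth.
  by apply: (measurable_kernel mg); exact: measurable_tnth.
have F0 t : 0 <= F t by exact: mule_ge0.
transitivity (\int[P]_w (F \o sample f) w).
  by apply: eq_integral => w _; rewrite /= /F !tnth_mktuple /f !inordK.
rewrite -(ge0_integral_distribution (sample f : {RV P >-> _}) mF F0).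
transitivity (\int[distribution (mu2 \x mu2) quad]_t F t).
  by apply: eq_measure_integral => B mB _; exact: quad_law.
rewrite ge0_integral_distribution//.
transitivity (\int[mu2 \x mu2]_z (h z.1.1 z.1.2 * g z.2.1 z.2.2)).
  apply: eq_integral => z _; rewrite /F /= !(tnth_nth z.1.1)/= !inordK//.
rewrite fubini_tonelli1/=; last 2 first.
- have m1 := @measurable_fst _ _ (T * T)%type (T * T)%type.
  have m2 := @measurable_snd _ _ (T * T)%type (T * T)%type.
  apply: emeasurable_funM.
    by apply: (measurable_kernel mh); exact: measurableT_comp.
  by apply: (measurable_kernel mg); exact: measurableT_comp.
- by move=> z; exact: mule_ge0.
rewrite /fubini_F/=.
under eq_integral => z _ do rewrite ge0_integralZl//.
rewrite ge0_integralZr//; last exact: integral_ge0.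
by rewrite /energy !fubini_tonelli1.
Qed.

Lemma energy_prod (h : T -> T -> \bar R) :
  measurable_fun setT (fun z : T * T => h z.1 z.2) ->
  (forall x y, 0 <= h x y) -> energy h = \int[mu \x mu]_z h z.1 z.2.
Proof. by move=> mh h0; rewrite /energy fubini_tonelli1. Qed.

Lemma energy_cst (r : R) : energy (fun _ _ => r%:E) = r%:E.
Proof.
have c : \int[mu]_x r%:E = r%:E.
  by rewrite integral_cst//= probability_setT mule1.
by rewrite /energy; under eq_integral do rewrite c; exact: c.
Qed.

(** The case g = 1 of [integral_disjoint_pairs], where k and l can be any two
    further indices. *)
Lemma integral_pair (h : T -> T -> \bar R) (i j : nat) :
  i != j -> measurable_fun setT (fun z : T * T => h z.1 z.2) ->
  (forall x y, 0 <= h x y) ->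
  \int[P]_w h (X i w) (X j w) = energy h.
Proof.
move=> ij mh h0.
rewrite -[RHS]mule1 -(energy_cst 1).
rewrite -(@integral_disjoint_pairs h _ i j (i + j).+1 (i + j).+2)//.
- by apply: eq_integral => w _; rewrite mule1.
- by move: ij; rewrite /= !inE !negb_or; lia.
Qed.

(** The sample is seen as a random sequence, of which G reads the first n
    terms only; s may move indices below n beyond n. *)
Lemma exchangeable n (G : (nat -> T) -> \bar R) (s : nat -> nat) :
  (forall x y, (forall i, (i < n)%N -> x i = y i) -> G x = G y) ->
  measurable_fun setT (fun t : n.-tuple T => G (nth point t)) ->
  (forall x, 0 <= G x) -> injective s ->
  \int[P]_w G (X^~ w) = \int[P]_w G (fun i => X (s i) w).
Proof.
move=> locG mG G0 sI.
have E f : \int[P]_w G (fun i => X (f i) w) =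
    \int[P]_w G (nth point (sample (fun i : 'I_n => f i) w)).
  apply: eq_integral => w _; apply: locG => i ni.
  by rewrite (nth_map (Ordinal ni)) ?size_enum_ord// nth_enum_ord.
rewrite (E id) (E s).
apply: (@integral_sample _ _ _ (fun t : n.-tuple T => G (nth point t))) => //.
- exact: val_inj.
- by move=> i j /sI; exact: val_inj.
Qed.

End tuple_laws.

Section conditional_sums.
Local Open Scope ereal_scope.
Context {d : measure_display} {S : measurableType d} {R : realType}.
Context {I : Type} (r : seq I) (D : pred I) (f : I -> S -> \bar R).
Hypothesis mf : forall i, measurable_fun setT (f i).

Lemma emeasurable_sum_cond :
  measurable_fun setT (fun x => \sum_(i <- r | D i) f i x).
Proof.
by under eq_fun do rewrite -big_filter; exact: emeasurable_sum.
Qed.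

Lemma ge0_integral_sum_cond (mu : {measure set S -> \bar R}) :
  (forall i x, 0 <= f i x) ->
  \int[mu]_x (\sum_(i <- r | D i) f i x) =
  \sum_(i <- r | D i) \int[mu]_x f i x.
Proof.
move=> f0; rewrite -big_filter -ge0_integral_sum//.
by apply: eq_integral => x _; rewrite big_filter.
Qed.

End conditional_sums.

(** * U-statistics of order two *)

Section ustatistics.
Local Open Scope ereal_scope.
Context {T : Type} {R : realType}.
Implicit Types (h : T -> T -> \bar R) (x : nat -> T).

Definition pair_sum h n x : \bar R :=
  \sum_(j < n) \sum_(k < n | j != k) h (x j) (x k).

Definition ustat h n x : \bar R := ((n * n.-1)%:R^-1)%:E * pair_sum h n x.

(** An injection of nat that maps [0, n) to itself permutes [0, n), so it
    merely reindexes the sum. *)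
Lemma pair_sum_perm h n x (s : nat -> nat) :
  injective s -> (forall i, (i < n)%N -> (s i < n)%N) ->
  pair_sum h n (x \o s) = pair_sum h n x.
Proof.
move=> sI sn; pose o (i : 'I_n) := Ordinal (sn i (ltn_ord i)).
have oI : injective o by move=> i j /(congr1 val)/= /sI; exact: val_inj.
rewrite /pair_sum [RHS](reindex_inj oI); apply: eq_bigr => i _.
rewrite [RHS](reindex_inj oI); apply: eq_bigl => j.
by rewrite (inj_eq oI).
Qed.

Lemma ustat_perm h n x (s : nat -> nat) :
  injective s -> (forall i, (i < n)%N -> (s i < n)%N) ->
  ustat h n (x \o s) = ustat h n x.
Proof. by move=> sI sn; rewrite /ustat pair_sum_perm. Qed.

Lemma eq_ustat h n x y : (forall i, (i < n)%N -> x i = y i) ->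
  ustat h n x = ustat h n y.
Proof.
move=> xy; congr (_ * _); apply: eq_bigr => i _; apply: eq_bigr => j _.
by rewrite !xy.
Qed.

Lemma pair_sum_ge0 h n x : (forall a b, 0 <= h a b) -> 0 <= pair_sum h n x.
Proof. by move=> h0; apply: sume_ge0 => i _; apply: sume_ge0. Qed.

Lemma ustat_ge0 h n x : (forall a b, 0 <= h a b) -> 0 <= ustat h n x.
Proof.
by move=> h0; rewrite mule_ge0 ?pair_sum_ge0// lee_fin invr_ge0.
Qed.

Lemma ustatD h g n x : (forall a b, 0 <= h a b) -> (forall a b, 0 <= g a b) ->
  ustat (fun a b => h a b + g a b) n x = ustat h n x + ustat g n x.
Proof.
move=> h0 g0; rewrite /ustat -ge0_muleDr ?pair_sum_ge0//; congr (_ * _).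
by rewrite /pair_sum -big_split/=; apply: eq_bigr => i _; rewrite big_split.
Qed.

Lemma pair_sum_cst n x (c : \bar R) : 0 <= c ->
  pair_sum (fun _ _ => c) n x = (n * n.-1)%:R%:E * c.
Proof.
move=> c0; have E m (y : \bar R) : (y *+ m)%R = m%:R%:E * y.
  by rewrite mule_natl.
rewrite natrM EFinM -muleA -!E -[in RHS](card_ord n) -sumr_const.
apply: eq_bigr => i _; rewrite [in RHS]card_ord.
rewrite (eq_bigl [in predC1 i]) ?sumr_const ?cardC1 ?card_ord//.
by move=> j; rewrite !inE eq_sym.
Qed.

End ustatistics.

Definition nat_swap (a b k : nat) : nat :=
  if k == a then b else if k == b then a else k.

Lemma nat_swap_inj a b : injective (nat_swap a b).
Proof. by move=> i j; rewrite /nat_swap; do !case: ifPn; lia. Qed.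

Lemma nat_swap_lt a b n i : (a < n -> b < n -> i < n -> nat_swap a b i < n)%N.
Proof. by rewrite /nat_swap; do !case: ifPn. Qed.

(** * The maximal inequality *)

Section maximal.
Local Open Scope ereal_scope.
Context {dT : measure_display} {T : measurableType dT} {R : realType}
  (h : T -> T -> \bar R).
Hypothesis mh : measurable_fun setT (fun z : T * T => h z.1 z.2).
Hypothesis h0 : forall x y, 0 <= h x y.

Lemma measurable_ustat dS (S : measurableType dS) (xs : nat -> S -> T) n :
  (forall i, measurable_fun setT (xs i)) ->
  measurable_fun setT (fun s => ustat h n (xs^~ s)).
Proof.
move=> mxs; rewrite /ustat; apply: emeasurable_funM => //.
apply: emeasurable_sum => i; apply: emeasurable_sum_cond => j.
exact: measurable_kernel.
Qed.

Lemma measurable_nth n k :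
  measurable_fun setT (fun t : n.-tuple T => nth point t k).
Proof.
have [kn|nk] := ltnP k n.
  rewrite (_ : (fun _ => _) = fun t : n.-tuple T => tnth t (Ordinal kn)).
    exact: measurable_tnth.
  by apply/funext => t; rewrite (tnth_nth point).
rewrite (_ : (fun _ => _) = cst point)//.
by apply/funext => t; rewrite nth_default// size_tuple.
Qed.

(** The last exit rather than the first passage: its definition involves only
    averages over at least n points, all of which are symmetric in the first n
    points. *)
Definition last_exceed (l : R) (N n : nat) : set (nat -> T) :=
  [set x | l%:E < ustat h n x] `&`
  \bigcap_(m in [set m | (n < m <= N)%N]) [set x | ustat h m x <= l%:E].

Lemma measurable_last_exceed dS (S : measurableType dS) (xs : nat -> S -> T)
    l N n : (forall i, measurable_fun setT (xs i)) ->
  measurable [set s | last_exceed l N n (xs^~ s)].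
Proof.
move=> mxs; have mU k := measurable_ustat k mxs.
rewrite [X in measurable X](_ : _ = [set s | l%:E < ustat h n (xs^~ s)] `&`
  \bigcap_(m in [set m | (n < m <= N)%N]) [set s | ustat h m (xs^~ s) <= l%:E]).
  apply: measurableI.
    by rewrite -[X in measurable X]setTI; exact: emeasurable_fun_o_infty.
  apply: bigcap_measurableType => m _.
  by rewrite -[X in measurable X]setTI; exact: emeasurable_fun_infty_c.
by apply/seteqP; split.
Qed.

Lemma last_exceed_perm l N n (x : nat -> T) (s : nat -> nat) :
  injective s -> (forall m i, (n <= m -> i < m -> s i < m)%N) ->
  last_exceed l N n (fun i => x (s i)) = last_exceed l N n x.
Proof.
move=> sI sm; rewrite /last_exceed /setI /bigcap/=; apply/propext.
have E := ustat_perm; rewrite /comp in E.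
rewrite E//; last by move=> i; exact: sm.
by split => -[nx mx]; split => // m nm; have := mx m nm;
  rewrite E// => i; apply: sm; case/andP: nm => /ltnW.
Qed.

Lemma last_exceed_local l N n (x y : nat -> T) : (n <= N)%N ->
  (forall i, (i < N)%N -> x i = y i) ->
  last_exceed l N n x = last_exceed l N n y.
Proof.
move=> nN xy; have E k : (k <= N)%N -> ustat h k x = ustat h k y.
  by move=> kN; apply: eq_ustat => i ik; rewrite xy// (leq_trans ik).
rewrite /last_exceed /setI /bigcap/=; apply/propext; rewrite (E n)//.
by split => -[nx mx]; split => // m nm; have := mx m nm; rewrite E//;
  case/andP: nm.
Qed.

Lemma last_exceed_disjoint l N (x : nat -> T) n m :
  (n <= N)%N -> (m <= N)%N ->
  last_exceed l N n x -> last_exceed l N m x -> n = m.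
Proof.
wlog nm : n m / (n < m)%N => [H nN mN nx mx|nN mN [_ nx] [mx _]].
  by have [nm|mn|//] := ltngtP n m; [exact: H|apply/esym/H].
have := nx m; rewrite /= nm mN => /(_ isT).
by rewrite leNgt mx.
Qed.

Lemma last_exceedP l N (x : nat -> T) n : (n <= N)%N -> l%:E < ustat h n x ->
  exists2 m, (m <= N)%N & last_exceed l N m x.
Proof.
move=> nN lx.
have ex : exists n, (n <= N)%N && (l%:E < ustat h n x) by exists n; rewrite nN.
have ub m : (m <= N)%N && (l%:E < ustat h m x) -> (m <= N)%N by case/andP.
case: (ex_maxnP ex ub) => m /andP[mN lm] mmax; exists m => //; split => //=.
move=> k /= /andP[mk kN]; rewrite leNgt; apply/negP => lk.
by have := mmax k; rewrite kN lk => /(_ isT); rewrite leqNgt mk.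
Qed.

Context {dO : measure_display} {Omega : measurableType dO}
  {P : probability Omega R} (mu : probability T R)
  (X : nat -> {RV P >-> T}).
Hypothesis X_iid : iid_with_law X mu.

Let Xs w : nat -> T := X^~ w.
Let mX i : measurable_fun setT (X i). Proof. exact: measurable_funP. Qed.

Let Q l N n (i j : nat) := \int[P]_w
  (h (X i w) (X j w) * (\1_(last_exceed l N n) (Xs w))%:E).

Let mQ l N n dS (S : measurableType dS) (xs : nat -> S -> T) i j :
  (forall i, measurable_fun setT (xs i)) ->
  measurable_fun setT (fun s => h (xs i s) (xs j s) *
    (\1_(last_exceed l N n) (xs^~ s))%:E).
Proof.
move=> mxs; apply: emeasurable_funM; first exact: measurable_kernel.
have mE := measurable_last_exceed l N n mxs.
apply/measurable_EFinP; exact: (measurable_indic mE).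
Qed.

(* Exchangeability, for a permutation of the first n indices, which preserves
   the event, chosen to send (0, 1) to (i, j). *)
Let Q_pair l N n i j : (2 <= n <= N)%N -> (i < n)%N -> (j < n)%N -> i != j ->
  Q l N n i j = Q l N n 0 1.
Proof.
move=> /andP[n2 nN] iN jN ij.
(* The inner swap fixes 0, because the outer one is injective and i != j. *)
pose s := nat_swap 0 i \o nat_swap 1 (nat_swap 0 i j).
have sI : injective s by apply: inj_comp; exact: nat_swap_inj.
have s0 : s 0%N = i by rewrite /s /= /nat_swap; do !case: ifPn; lia.
have s1 : s 1%N = j by rewrite /s /= /nat_swap; do !case: ifPn; lia.
have sm m k : (n <= m -> k < m -> s k < m)%N.
  move=> nm km; rewrite /s/=.
  have jm : (nat_swap 0 i j < m)%N by apply: nat_swap_lt; lia.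
  by apply: nat_swap_lt; [lia..|apply: nat_swap_lt => //; lia].
pose G (x : nat -> T) := h (x 0%N) (x 1%N) * (\1_(last_exceed l N n) x)%:E.
rewrite /Q; apply/esym.
rewrite (@exchangeable _ _ _ _ _ _ _ _ X_iid N G s)//.
- apply: eq_integral => w _; rewrite /G s0 s1 /Xs; congr (_ * _%:E).
  rewrite !indicE; congr (_%:R).
  have H := last_exceed_perm l N (X^~ w) sI sm.
  congr nat_of_bool; apply/idP/idP => /set_mem xL; apply/mem_set.
    by rewrite -H.
  by rewrite H.
- move=> x y xy; rewrite /G !xy; [|lia..]; congr (_ * _%:E).
  rewrite !indicE; congr (_%:R).
  have H := last_exceed_local l nN xy.
  congr nat_of_bool; apply/idP/idP => /set_mem xL; apply/mem_set.
    by rewrite -H.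
  by rewrite H.
- exact: (@mQ l N n _ _ (fun k (t : N.-tuple T) => nth point t k) 0 1
    (fun k => measurable_nth k)).
- by move=> x; rewrite mule_ge0// lee_fin.
Qed.

(* On the event, l < U_n; all the n (n - 1) pairs in U_n have the same integral
   over it, which is therefore the integral of U_n. *)
Let exceed_le (l : R) N n : (0 < l)%R -> (n <= N)%N ->
  l%:E * P [set w | last_exceed l N n (Xs w)] <= Q l N n 0 1.
Proof.
move=> l0 nN.
have mL := measurable_last_exceed l N n mX.
(* For n < 2 there is no pair, and the convention 0^-1 = 0 gives U_n = 0 < l. *)
have [n2|n2] := leqP 2 n; last first.
  rewrite (_ : [set w | _] = set0) ?measure0 ?mule0.
    by apply: integral_ge0 => w _; rewrite mule_ge0// lee_fin.
  rewrite -subset0 => w /= [+ _]; rewrite /= /ustat.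
  have -> : (n * n.-1 = 0)%N by case: n n2 {nN mL} => [|[|]].
  by rewrite invr0 mul0e lte_fin ltNge (ltW l0).
pose c : R := ((n * n.-1)%:R^-1)%R.
have c0 : (0 <= c)%R by rewrite invr_ge0.
have Q0 i j w : 0 <= h (X i w) (X j w) * (\1_(last_exceed l N n) (Xs w))%:E.
  by rewrite mule_ge0// lee_fin.
apply: (@le_trans _ _ (\int[P]_w (c%:E * \sum_(i < n) \sum_(j < n | i != j)
    (h (X i w) (X j w) * (\1_(last_exceed l N n) (Xs w))%:E)))).
  rewrite -integral_cst//= integral_mkcond.
  apply: ge0_le_integral => //.
  - by move=> w _; rewrite /patch; case: ifP => // _; rewrite lee_fin ltW.
  - by apply/(iffLR (measurable_restrictT _ mL)); exact: measurable_cst.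
  - apply: emeasurable_funM => //; apply: emeasurable_sum => i.
    by apply: emeasurable_sum_cond => j; exact: (mQ _ _ _ _ _ mX).
  - move=> w _; rewrite /patch; case: ifPn => wL; last first.
      by rewrite mule_ge0// sume_ge0// => i _; rewrite sume_ge0.
    have -> : (\1_(last_exceed l N n) (Xs w))%:E = 1 :> \bar R.
      by rewrite indicE; move: wL; rewrite !inE => wL; rewrite mem_set.
    under eq_bigr do under eq_bigr do rewrite mule1.
    by move: wL; rewrite inE => -[/ltW].
rewrite ge0_integralZl_EFin//; last 2 first.
- by move=> w _; rewrite sume_ge0// => i _; rewrite sume_ge0.
- apply: emeasurable_sum => i.
  by apply: emeasurable_sum_cond => j; exact: (mQ _ _ _ _ _ mX).
rewrite ge0_integral_sum//; last 2 first.
- by move=> i; apply: emeasurable_sum_cond => j; exact: (mQ _ _ _ _ _ mX).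
- by move=> i w _; rewrite sume_ge0.
rewrite (eq_bigr (fun i : 'I_n => \sum_(j < n | i != j) Q l N n 0 1)).
2: { move=> i _; rewrite ge0_integral_sum_cond//; last first.
       by move=> j; exact: (mQ _ _ _ _ _ mX).
     by apply: eq_bigr => j ij; apply: Q_pair => //; rewrite n2. }
have := @pair_sum_cst T R n point (Q l N n 0 1).
rewrite /pair_sum => ->; last by apply: integral_ge0 => w _; exact: Q0.
rewrite muleA -EFinM mulVf ?mul1e//.
by rewrite pnatr_eq0; lia.
Qed.

Let exceed_upto (l : R) N := [set w | exists2 n, (n <= N)%N &
  l%:E < ustat h n (Xs w)].

Let measurable_exceed_upto l N : measurable (exceed_upto l N).
Proof.
rewrite (_ : exceed_upto l N = \bigcup_(n in [set n | (n <= N)%N])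
  [set w | l%:E < ustat h n (Xs w)]).
  apply: bigcup_measurable => n _; rewrite -[X in measurable X]setTI.
  by apply: emeasurable_fun_o_infty => //; exact: measurable_ustat.
by apply/seteqP; split => w [n nN lU]; exists n.
Qed.

Let exceed_upto_le (l : R) N : (0 < l)%R ->
  l%:E * P (exceed_upto l N) <= energy mu h.
Proof.
move=> l0.
pose E n := [set w | last_exceed l N n (Xs w)].
have mE n : measurable (E n) by exact: measurable_last_exceed.
apply: (@le_trans _ _ (l%:E * \sum_(n < N.+1) P (E n))).
  apply: lee_wpmul2l; first by rewrite lee_fin ltW.
  apply: le_trans (@Boole_inequality _ _ _ P E N.+1 _) => //.
  apply: le_measure; rewrite ?inE//; first exact: bigsetU_measurable.
  move=> w [n nN /(last_exceedP nN)[m mN Lm]].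
  by rewrite -bigcup_mkord; exists m.
rewrite ge0_sume_distrr//.
apply: (@le_trans _ _ (\sum_(n < N.+1) Q l N n 0 1)).
  by apply: lee_sum => n _; apply: exceed_le => //; rewrite -ltnS.
rewrite /Q -ge0_integral_sum//; last 2 first.
- by move=> n; exact: (mQ _ _ _ _ _ mX).
- by move=> n w _; rewrite mule_ge0// lee_fin.
rewrite -(integral_pair X_iid (i := 0) (j := 1) _ mh h0)//.
apply: ge0_le_integral => //.
- by move=> w _; apply: sume_ge0 => n _; rewrite mule_ge0// lee_fin.
- by apply: emeasurable_sum => n; exact: (mQ _ _ _ _ _ mX).
- exact: measurable_kernel.
move=> w _; rewrite -ge0_sume_distrr; last by move=> n _; rewrite lee_fin.
rewrite -[leRHS]mule1; apply: lee_wpmul2l => //.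
have [[n Ln]|noL] := pselect (exists n : 'I_N.+1, last_exceed l N n (Xs w)).
  rewrite (bigD1 n)//= big1 ?adde0.
    by rewrite lee_fin indicE lern1 leq_b1.
  move=> m mn; rewrite indicE memNset//= => Lm; move/eqP: mn; apply.
  by apply/val_inj/(last_exceed_disjoint _ _ Lm Ln); rewrite -ltnS.
rewrite big1// => n _; rewrite indicE memNset// => Ln; apply: noL.
by exists n.
Qed.

(** Doob's maximal inequality for the reversed martingale U_n; the bound for the
    indices up to N does not depend on N. *)
Lemma ustat_maximal (l : R) : (0 < l)%R ->
  P [set w | exists n, l%:E < ustat h n (Xs w)] <= (l^-1)%:E * energy mu h.
Proof.
move=> l0.
have le N : P (exceed_upto l N) <= (l^-1)%:E * energy mu h.
  rewrite -[leLHS]mul1e -(mulVf (lt0r_neq0 l0)) EFinM -muleA.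
  by rewrite lee_wpmul2l ?exceed_upto_le// lee_fin invr_ge0 ltW.
rewrite (_ : [set w | _] = \bigcup_N exceed_upto l N).
  have cvP : P (exceed_upto l N) @[N --> \oo] --> P (\bigcup_N exceed_upto l N).
    apply: nondecreasing_cvg_mu => //; first exact: bigcup_measurable.
    move=> a b ab; apply/subsetPset => w [n na ln]; exists n => //.
    exact: leq_trans ab.
  rewrite -(cvg_lim _ cvP)//; apply: lime_le.
    by apply/cvg_ex; eexists; exact: cvP.
  exact: nearW.
apply/seteqP; split => [w [n ln]|w [N _ [n _ ln]]]; last by exists n.
by exists n => //; exists n.
Qed.

End maximal.

(** * Passing from squares to all indices *)

Section real_sequences.
Context {R : realType}.
Implicit Types (u : R^nat) (l : R).

(** Telescoping, from 1 / m^2 <= 2 / (m (m + 1)). *)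
Lemma sum_inv_sqr_le N :
  \sum_(m < N) ((m.+1%:R ^+ 2)^-1 : R) <= 2 * (1 - N.+1%:R^-1).
Proof.
elim: N => [|N IH]; first by rewrite big_ord0 invr1 subrr mulr0.
rewrite big_ord_recr/= (le_trans (lerD IH (lexx _)))//.
have a0 : (0 : R) < N.+1%:R by [].
have e : N.+2%:R = N.+1%:R + 1 :> R by rewrite -natr1.
rewrite e; set a := N.+1%:R in a0 *.
have a1 : 1 <= a by rewrite /a ler1n.
rewrite -subr_ge0.
have -> : 2 * (1 - (a + 1)^-1) - (2 * (1 - a^-1) + (a ^+ 2)^-1) =
   (a - 1) / (a ^+ 2 * (a + 1)).
  by field; lra.
by apply: divr_ge0; [lra|rewrite mulr_ge0 ?sqr_ge0//; lra].
Qed.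

Lemma between_squares n : (0 < n)%N ->
  exists p, (p.+1 ^ 2 <= n < p.+2 ^ 2)%N.
Proof.
elim: n => // n IH _; have [->|n0] := posnP n; first by exists 0%N.
have [p /andP[pn np]] := IH n0.
have [lt|ge] := ltnP n.+1 (p.+2 ^ 2); first by exists p; rewrite (leqW pn) lt.
by exists p.+1; rewrite ge/=; lia.
Qed.

(** For (p + 1)^2 <= n < (p + 2)^2, the quotient u n / n^2 is squeezed between
    the quotients at the two squares, up to the factor ((p + 2) / (p + 1))^4,
    which tends to 1. *)
Lemma cvg_between_squares u l : nondecreasing_seq u -> (forall n, 0 <= u n) ->
  u (m.+1 ^ 2)%N / (m.+1 ^ 2)%:R ^+ 2 @[m --> \oo] --> l ->
  u n / n%:R ^+ 2 @[n --> \oo] --> l.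
Proof.
move=> undec u0 ul.
have /choice[p pP] : forall n, exists p,
    (0 < n)%N -> (p.+1 ^ 2 <= n < p.+2 ^ 2)%N.
  move=> n; have [->|n0] := posnP n; first by exists 0%N.
  by have [p pn] := between_squares n0; exists p.
have p_oo : p n @[n --> \oo] --> \oo.
  apply/cvgnyPge => A; exists (A.+2 ^ 2)%N => // n /= An.
  have n0 : (0 < n)%N by lia.
  by have /andP[_ np] := pP n n0; nia.
set v := fun m => u (m.+1 ^ 2)%N / (m.+1 ^ 2)%:R ^+ 2 in ul.
pose r (m : nat) : R := 1 + m.+1%:R^-1.
have r1 : r m @[m --> \oo] --> (1 : R).
  rewrite -[X in _ --> X]addr0; apply: cvgD; first exact: cvg_cst.
  exact: cvg_harmonic.
have r4 : r m ^+ 4 @[m --> \oo] --> (1 : R).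
  rewrite -(expr1n R 4); apply: (@cvg_comp _ _ _ r (fun x => x ^+ 4) _ _ _ r1).
  exact: exprn_continuous.
have lo : v (p n) / r (p n) ^+ 4 @[n --> \oo] --> l.
  have vr : v m / r m ^+ 4 @[m --> \oo] --> l.
    rewrite -[X in _ --> X]divr1; apply: cvgM => //.
    by apply: cvgV => //; exact: oner_neq0.
  exact: cvg_comp p_oo vr.
have hi : v (p n).+1 * r (p n) ^+ 4 @[n --> \oo] --> l.
  have vr : v m.+1 * r m ^+ 4 @[m --> \oo] --> l.
    rewrite -[X in _ --> X]mulr1; apply: cvgM => //.
    by rewrite -(cvg_shiftS v) in ul.
  exact: cvg_comp p_oo vr.
apply: squeeze_cvgr lo hi.
exists 1%N => // n /= n0; have /andP[pn np] := pP n n0.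
rewrite /v /r.
set q := p n in pn np *.
have q0 : (0 : R) < q.+1%:R by [].
have e : q.+2%:R = q.+1%:R + 1 :> R by rewrite -natr1.
have -> : 1 + q.+1%:R^-1 = q.+2%:R / q.+1%:R :> R by rewrite e; field; lra.
have nR : (0 : R) < n%:R by rewrite ltr0n.
have pnR : q.+1%:R ^+ 2 <= n%:R :> R by rewrite -natrX ler_nat.
have npR : n%:R <= q.+2%:R ^+ 2 :> R by rewrite -natrX ler_nat ltnW.
have q2 : (0 : R) < q.+2%:R by [].
rewrite !natrX.
have -> : u (q.+1 ^ 2)%N / (q.+1%:R ^+ 2) ^+ 2 / (q.+2%:R / q.+1%:R) ^+ 4 =
   u (q.+1 ^ 2)%N / (q.+2%:R ^+ 2) ^+ 2.
  by field; rewrite !gt_eqF.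
have -> : u (q.+2 ^ 2)%N / (q.+2%:R ^+ 2) ^+ 2 * (q.+2%:R / q.+1%:R) ^+ 4 =
   u (q.+2 ^ 2)%N / (q.+1%:R ^+ 2) ^+ 2.
  by field; rewrite !gt_eqF.
apply/andP; split; apply: ler_pM => //.
- exact: undec.
- by rewrite lef_pV2 ?posrE ?exprn_gt0// lerXn2r// nnegrE ?ltW// exprn_ge0.
- exact/undec/ltnW.
- by rewrite lef_pV2 ?posrE ?exprn_gt0// lerXn2r// nnegrE ?ltW// exprn_gt0.
Qed.

Lemma cvg_div_pairs u l : u n / n%:R ^+ 2 @[n --> \oo] --> l ->
  (n * n.-1)%:R^-1 * u n @[n --> \oo] --> l.
Proof.
move=> ul.
have r1 : 1 + n.+1%:R^-1 @[n --> \oo] --> (1 : R).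
  rewrite -[X in _ --> X]addr0; apply: cvgD; first exact: cvg_cst.
  exact: cvg_harmonic.
have {}r1 : 1 + n.-1%:R^-1 @[n --> \oo] --> (1 : R).
  rewrite -(cvg_shiftS (fun n => 1 + n.-1%:R^-1 : R)).
  by rewrite -(cvg_shiftS (fun n => 1 + n.+1.-1%:R^-1 : R)).
have H := cvgM ul r1; rewrite mulr1 in H.
apply: cvg_trans (H _); apply: near_eq_cvg.
exists 2%N => //= -[|[|n]] //= _.
have e : n.+2%:R = n.+1%:R + 1 :> R by rewrite -natr1.
have n0 : (0 : R) < n.+1%:R by [].
by rewrite natrM !e; field; lra.
Qed.

End real_sequences.

(** * The strong law for bounded kernels *)

Section summable_moments.
Local Open Scope ereal_scope.
Context {dO : measure_display} {Omega : measurableType dO} {R : realType}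
  (P : probability Omega R).

(** The series of the Y m has finite integral, so it converges almost surely
    and its terms tend to 0. *)
Lemma ae_cvg0_of_summable_integrals (Y : nat -> Omega -> R) (c : nat -> R)
    (C : R) :
  (forall m, measurable_fun setT (Y m)) -> (forall m w, (0 <= Y m w)%R) ->
  (forall m, \int[P]_w (Y m w)%:E <= (c m)%:E) ->
  (forall N, (\sum_(m < N) c m <= C)%R) ->
  {ae P, forall w, Y m w @[m --> \oo] --> (0 : R)%R}.
Proof.
move=> mY Y0 Yc cC.
pose S w := \sum_(0 <= m <oo) (Y m w)%:E.
have S0 w : 0 <= S w by apply: nneseries_ge0 => m _ _; rewrite lee_fin.
have mYE m : measurable_fun setT (fun w => (Y m w)%:E).
  exact/measurable_EFinP.
have mS : measurable_fun setT S.
  by apply: ge0_emeasurable_sum => // m w _ _; rewrite lee_fin.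
have iS : P.-integrable setT S.
  apply/integrableP; split => //.
  under eq_integral do rewrite gee0_abs//.
  rewrite /S integral_nneseries//; last by move=> m w _; rewrite lee_fin.
  apply: (@le_lt_trans _ _ C%:E); last exact: ltry.
  apply: lime_le.
    apply: is_cvg_nneseries => m _ _.
    by apply: integral_ge0 => w _; rewrite lee_fin.
  apply: nearW => N; rewrite big_mkord.
  apply: (@le_trans _ _ (\sum_(m < N) (c m)%:E)); first exact: lee_sum.
  by rewrite sumEFin lee_fin.
have := integrable_ae measurableT iS; apply: filterS => w /(_ I) Sfin.
apply: cvg_series_cvg_0; apply: nondecreasing_is_cvgn.
  by apply: nondecreasing_series => m _ _.
exists (fine (S w)) => _ [N _ <-].
rewrite -lee_fin fineK// /series/= -sumEFin.
by apply: nneseries_lim_ge => m _ _; rewrite lee_fin.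
Qed.

End summable_moments.

Section bounded_kernels.
Context {dT : measure_display} {T : measurableType dT} {R : realType}
  (k : T -> T -> R) (M : R).
Hypothesis mk : measurable_fun setT (fun z : T * T => k z.1 z.2).
Hypothesis k0 : forall x y, 0 <= k x y.
Hypothesis kM : forall x y, k x y <= M.

(** [pair_sum] in the reals, indexed by pairs so that its square is a sum over
    pairs of pairs. *)
Definition rpair_sum n (x : nat -> T) : R :=
  \sum_(p : 'I_n * 'I_n | p.1 != p.2) k (x p.1) (x p.2).

Lemma rpair_sumE n x :
  pair_sum (fun a b => (k a b)%:E) n x = (rpair_sum n x)%:E.
Proof.
rewrite /pair_sum /rpair_sum -sumEFin.
exact: (pair_big_dep xpredT (fun i j : 'I_n => i != j)
  (fun i j => (k (x i) (x j))%:E)).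
Qed.

Lemma rpair_sum_nd x : nondecreasing_seq (rpair_sum ^~ x).
Proof.
have E m : rpair_sum m x =
    \sum_(i < m) \sum_(j < m) if (i : nat) != j then k (x i) (x j) else 0.
  rewrite pair_bigA/= -big_mkcond/=.
  by apply: eq_bigl => p.
apply/nondecreasing_seqP => n; rewrite !E big_ord_recr/=.
apply: ler_wpDr; first by apply: sumr_ge0 => j _; case: ifP.
apply: ler_sum => i _; rewrite big_ord_recr/=; apply: ler_wpDr => //.
by case: ifP.
Qed.

Lemma sum_pairs_cst n (c : R) : 0 <= c ->
  \sum_(p : 'I_n * 'I_n | p.1 != p.2) c = (n * n.-1)%:R * c.
Proof.
move=> c0; apply: EFin_inj; rewrite EFinM -sumEFin.
rewrite -(@pair_sum_cst T R n point c%:E)// /pair_sum.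
apply/esym.
exact: (pair_big_dep xpredT (fun i j : 'I_n => i != j) (fun i j => c%:E)).
Qed.

Lemma rpair_sum_ge0 n x : 0 <= rpair_sum n x.
Proof. by apply: sumr_ge0. Qed.

Context {dO : measure_display} {Omega : measurableType dO}
  {P : probability Omega R} (mu : probability T R)
  (X : nat -> {RV P >-> T}).
Hypothesis X_iid : iid_with_law X mu.

Let V n w := rpair_sum n (X^~ w).

Let mk_pair (i j : nat) : measurable_fun setT (fun w => k (X i w) (X j w)).
Proof. by apply: (measurable_kernel mk); exact: measurable_funP. Qed.

Let mV n : measurable_fun setT (V n).
Proof.
rewrite /V /rpair_sum; under eq_fun do rewrite big_mkcond/=.
by apply: measurable_sum => p; case: (p.1 != p.2).
Qed.

Let mkE : measurable_fun setT (fun z : T * T => (k z.1 z.2)%:E).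
Proof. exact/measurable_EFinP. Qed.

Let I := fine (energy mu (fun x y => (k x y)%:E)).

Let M0 : 0 <= M. Proof. exact: le_trans (k0 point point) (kM _ _). Qed.

Let energyE : energy mu (fun x y => (k x y)%:E) = I%:E.
Proof.
rewrite /I fineK// -(integral_pair X_iid (i := 0) (j := 1)) //.
rewrite ge0_fin_numE; last by apply: integral_ge0 => w _; rewrite lee_fin.
apply: (@le_lt_trans _ _ (\int[P]_w M%:E)%E).
  apply: ge0_le_integral => //; first by move=> w _; rewrite lee_fin.
    exact/measurable_EFinP.
  by move=> w _; rewrite lee_fin.
by rewrite integral_cst//= probability_setT mule1 ltry.
Qed.

Let I0 : 0 <= I.
Proof.
by apply: fine_ge0; apply: integral_ge0 => x _; apply: integral_ge0 => y _;
  rewrite lee_fin.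
Qed.

(* At least 1 as soon as the pairs p and q share an index. *)
Let overlap n (p q : 'I_n * 'I_n) : R :=
  (p.1 == q.1)%:R + (p.1 == q.2)%:R + ((p.2 == q.1)%:R + (p.2 == q.2)%:R).

Let overlap_ge0 n (p q : 'I_n * 'I_n) : 0 <= overlap p q.
Proof. by rewrite /overlap !addr_ge0. Qed.

Let sum_overlap n : \sum_(p : 'I_n * 'I_n) \sum_(q : 'I_n * 'I_n) overlap p q =
  4 * n%:R ^+ 3.
Proof.
have d (i : 'I_n) : \sum_(j < n) (i == j)%:R = 1 :> R.
  rewrite (bigD1 i)//= eqxx big1 ?addr0// => j ji.
  by rewrite eq_sym (negbTE ji).
have c (a : R) : \sum_(j < n) a = n%:R * a.
  by rewrite sumr_const card_ord mulr_natl.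
have s1 (i : 'I_n) : \sum_(q : 'I_n * 'I_n) (i == q.1)%:R = n%:R :> R.
  rewrite -(pair_bigA _ (fun a _ => (i == a)%:R))/=.
  by under eq_bigr do rewrite c; rewrite -mulr_sumr d mulr1.
have s2 (i : 'I_n) : \sum_(q : 'I_n * 'I_n) (i == q.2)%:R = n%:R :> R.
  rewrite -(pair_bigA _ (fun _ b => (i == b)%:R))/=.
  by under eq_bigr do rewrite d; rewrite c mulr1.
under eq_bigr do rewrite /overlap !big_split/= !s1 !s2.
rewrite sumr_const card_prod !card_ord -[LHS]mulr_natr natrM; ring.
Qed.

(* Disjoint pairs are independent; overlapping ones are bounded by M^2. *)
Let pair_product_le n (p q : 'I_n * 'I_n) : p.1 != p.2 -> q.1 != q.2 ->
  (\int[P]_w (k (X p.1 w) (X p.2 w) * k (X q.1 w) (X q.2 w))%:E <=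
   (I ^+ 2 + M ^+ 2 * overlap p q)%:E)%E.
Proof.
move=> pd qd.
have [u|nu] := boolP (uniq [:: p.1; p.2; q.1; q.2]).
  under eq_integral do rewrite EFinM.
  rewrite (integral_disjoint_pairs X_iid (h := fun a b => (k a b)%:E)
    (g := fun a b => (k a b)%:E))//.
  by rewrite energyE -EFinM lee_fin -expr2 lerDl mulr_ge0// sqr_ge0.
have ov1 : 1 <= overlap p q.
  move: nu pd qd; rewrite /overlap /= !inE.
  by do !case: (_ == _) => //=; lra.
apply: (@le_trans _ _ (\int[P]_w (M ^+ 2)%:E)%E).
  apply: ge0_le_integral => //.
  - by move=> w _; rewrite lee_fin mulr_ge0.
  - by apply/measurable_EFinP; apply: measurable_funM.
  - by move=> w _; rewrite lee_fin expr2; apply: ler_pM.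
rewrite integral_cst//= probability_setT mule1 lee_fin.
by rewrite (le_trans (ler_peMr (sqr_ge0 _) ov1))// lerDr sqr_ge0.
Qed.

Let a n : R := (n * n.-1)%:R * I.

Let integral_V n : (\int[P]_w (V n w)%:E = (a n)%:E)%E.
Proof.
under eq_integral do rewrite /V /rpair_sum -sumEFin.
rewrite ge0_integral_sum_cond; last 2 first.
- by move=> p; exact/measurable_EFinP.
- by move=> p w; rewrite lee_fin.
rewrite (eq_bigr (fun=> I%:E)); first by rewrite sumEFin sum_pairs_cst.
move=> p pd; rewrite -energyE.
by rewrite (integral_pair X_iid (h := fun a b => (k a b)%:E)).
Qed.

Let second_moment n :
  (\int[P]_w (V n w ^+ 2)%:E <= (a n ^+ 2 + 4 * M ^+ 2 * n%:R ^+ 3)%:E)%E.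
Proof.
pose F (p q : 'I_n * 'I_n) w :=
  (k (X p.1 w) (X p.2 w) * k (X q.1 w) (X q.2 w))%:E.
have F0 p q w : (0 <= F p q w)%E by rewrite lee_fin mulr_ge0.
have mF p q : measurable_fun setT (F p q).
  by apply/measurable_EFinP; exact: measurable_funM.
have -> : (\int[P]_w (V n w ^+ 2)%:E = \int[P]_w
    \sum_(p | p.1 != p.2) \sum_(q | q.1 != q.2) F p q w)%E.
  apply: eq_integral => w _; rewrite expr2 /V /rpair_sum big_distrlr/=.
  by rewrite -sumEFin; apply: eq_bigr => p _; rewrite sumEFin.
rewrite ge0_integral_sum_cond; last 2 first.
- by move=> p; exact: emeasurable_sum_cond.
- by move=> p w; exact: sume_ge0.
apply: (@le_trans _ _ (\sum_(p : 'I_n * 'I_n | p.1 != p.2)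
    \sum_(q : 'I_n * 'I_n | q.1 != q.2) (I ^+ 2 + M ^+ 2 * overlap p q)%:E)%E).
  apply: lee_sum => p pd; rewrite ge0_integral_sum_cond//.
  by apply: lee_sum => q qd; exact: pair_product_le.
under eq_bigr do rewrite sumEFin.
rewrite sumEFin lee_fin; under eq_bigr do rewrite big_split/=.
rewrite big_split/=; apply: lerD.
  under eq_bigr do rewrite sum_pairs_cst ?sqr_ge0//.
  by rewrite sum_pairs_cst ?mulr_ge0 ?sqr_ge0// /a; lra.
rewrite mulrAC -sum_overlap mulrC mulr_sumr.
apply: (@le_trans _ _ (\sum_(p : 'I_n * 'I_n)
    \sum_(q : 'I_n * 'I_n | q.1 != q.2) M ^+ 2 * overlap p q)).
  rewrite big_mkcond/=; apply: ler_sum => p _; case: ifP => // _.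
  by apply: sumr_ge0 => q _; rewrite mulr_ge0 ?sqr_ge0.
apply: ler_sum => p _; rewrite mulr_sumr big_mkcond/=; apply: ler_sum => q _.
by case: ifP => // _; rewrite mulr_ge0 ?sqr_ge0.
Qed.

(* E (V - a)^2 + 2 a E V = E V^2 + a^2 with E V = a: the identity is arranged so
   that only nonnegative functions are integrated. *)
Let variance_le n :
  (\int[P]_w ((V n w - a n) ^+ 2)%:E <= (4 * M ^+ 2 * n%:R ^+ 3)%:E)%E.
Proof.
have a0 : 0 <= a n by rewrite mulr_ge0.
have V0 w : 0 <= V n w by exact: rpair_sum_ge0.
have E : (\int[P]_w ((V n w - a n) ^+ 2)%:E + (2 * a n ^+ 2)%:E =
    \int[P]_w (V n w ^+ 2)%:E + (a n ^+ 2)%:E)%E.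
  transitivity (\int[P]_w
      (((V n w - a n) ^+ 2)%:E + (2 * a n)%:E * (V n w)%:E))%E.
    rewrite ge0_integralD//; last 4 first.
    - by move=> w _; rewrite lee_fin sqr_ge0.
    - by apply/measurable_EFinP; apply: measurable_funX; exact: measurable_funB.
    - by move=> w _; rewrite -EFinM lee_fin !mulr_ge0.
    - by apply: emeasurable_funM => //; exact/measurable_EFinP.
    rewrite ge0_integralZl_EFin//; last 3 first.
    - by move=> w _; rewrite lee_fin.
    - exact/measurable_EFinP.
    - by rewrite mulr_ge0.
    by rewrite integral_V -EFinM; congr (_ + _%:E)%E; ring.
  transitivity (\int[P]_w ((V n w ^+ 2)%:E + (a n ^+ 2)%:E))%E.
    by apply: eq_integral => w _; rewrite -EFinM -!EFinD; congr (_%:E); ring.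
  rewrite ge0_integralD//; last 3 first.
  - by move=> w _; rewrite lee_fin sqr_ge0.
  - by apply/measurable_EFinP; apply: measurable_funX.
  - by move=> w _; rewrite lee_fin sqr_ge0.
  by rewrite integral_cst//= probability_setT mule1.
rewrite -(@leeD2rE _ (2 * a n ^+ 2)%:E)// E.
rewrite (le_trans (leeD2r _ (second_moment n)))// -!EFinD lee_fin; lra.
Qed.

Let Y m w : R :=
  ((V (m.+1 ^ 2)%N w - a (m.+1 ^ 2)%N) / (m.+1 ^ 2)%:R ^+ 2) ^+ 2.

Let ae_squares : {ae P, forall w, Y m w @[m --> \oo] --> (0 : R)}.
Proof.
apply: (@ae_cvg0_of_summable_integrals _ _ _ _ _
   (fun m => 4 * M ^+ 2 * (m.+1%:R ^+ 2)^-1) (8 * M ^+ 2)).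
- move=> m; apply: measurable_funX; apply: measurable_funM => //.
  exact: measurable_funB.
- by move=> m w; rewrite sqr_ge0.
- move=> m; rewrite /Y; under eq_integral do rewrite expr_div_n mulrC EFinM.
  rewrite ge0_integralZl_EFin//; last 2 first.
  + by move=> w _; rewrite lee_fin sqr_ge0.
  + by apply/measurable_EFinP; apply: measurable_funX; exact: measurable_funB.
  apply: le_trans (lee_wpmul2l _ (variance_le _)) _.
    by rewrite lee_fin invr_ge0 sqr_ge0.
  rewrite -EFinM lee_fin natrX le_eqVlt; apply/orP; left; apply/eqP.
  by field.
- move=> N; rewrite -mulr_sumr.
  have := sum_inv_sqr_le N (R := R).
  set S := \sum_(m < N) _ => SN.
  have S2 : S <= 2.
    by rewrite (le_trans SN)// mulrBr mulr1 gerBl mulr_ge0// invr_ge0.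
  have := sqr_ge0 M; nra.
Qed.

Lemma strong_law_bounded :
  {ae P, forall w, ustat (fun x y => (k x y)%:E) n (X^~ w) @[n --> \oo] -->
     energy mu (fun x y => (k x y)%:E)}.
Proof.
apply: filterS ae_squares => w Yw.
rewrite energyE /ustat.
under eq_fun do rewrite rpair_sumE -EFinM.
apply: cvg_EFin; first exact: nearW.
apply: cvg_div_pairs; apply: cvg_between_squares.
- exact: rpair_sum_nd.
- by move=> n; exact: rpair_sum_ge0.
have y0 : (V (m.+1 ^ 2)%N w - a (m.+1 ^ 2)%N) / (m.+1 ^ 2)%:R ^+ 2
    @[m --> \oo] --> (0 : R).
  apply/norm_cvg0P.
  have sq0 : Num.sqrt x @[x --> (0 : R)] --> Num.sqrt (0 : R).
    exact: sqrt_continuous.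
  have := cvg_comp _ _ Yw sq0; rewrite sqrtr0.
  by rewrite (_ : _ \o _ = fun m => `|(V (m.+1 ^ 2)%N w - a (m.+1 ^ 2)%N) /
    (m.+1 ^ 2)%:R ^+ 2|)//; apply/funext => m; rewrite /= /Y sqrtr_sqr.
have aI : a (m.+1 ^ 2)%N / (m.+1 ^ 2)%:R ^+ 2 @[m --> \oo] --> I.
  have -> : (fun m => a (m.+1 ^ 2)%N / (m.+1 ^ 2)%:R ^+ 2) =
      (fun m => I - I * (m.+1%:R^-1 * m.+1%:R^-1)).
    apply/funext => m; rewrite /a natrM -subn1 natrB ?expn_gt0// natrX.
    by field.
  rewrite -[X in _ --> X]subr0 -[X in _ --> _ - X](mulr0 I).
  rewrite -[X in I * X](mulr0 0).
  apply: cvgB; first exact: cvg_cst.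
  by apply: cvgMr; apply: cvgM; exact: cvg_harmonic.
rewrite -[X in _ --> X]add0r.
have -> : (fun m => rpair_sum (m.+1 ^ 2) (X^~ w) / (m.+1 ^ 2)%:R ^+ 2) =
   (fun m => (V (m.+1 ^ 2)%N w - a (m.+1 ^ 2)%N) / (m.+1 ^ 2)%:R ^+ 2 +
      a (m.+1 ^ 2)%N / (m.+1 ^ 2)%:R ^+ 2).
  by apply/funext => m; rewrite -mulrDl subrK.
exact: cvgD.
Qed.

End bounded_kernels.

(** * The strong law for nonnegative kernels *)

Section strong_law.
Local Open Scope ereal_scope.
Context {dT : measure_display} {T : measurableType dT} {R : realType}
  (h : T -> T -> \bar R).
Hypothesis mh : measurable_fun setT (fun z : T * T => h z.1 z.2).
Hypothesis h0 : forall x y, 0 <= h x y.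

Context {dO : measure_display} {Omega : measurableType dO}
  {P : probability Omega R} (mu : probability T R)
  (X : nat -> {RV P >-> T}).
Hypothesis X_iid : iid_with_law X mu.

Let k (M : nat) x y : R := fine (mine (h x y) M%:R%:E).

Let kE M x y : (k M x y)%:E = mine (h x y) M%:R%:E.
Proof.
rewrite /k fineK// ge0_fin_numE; first by rewrite gt_min ltry orbT.
by rewrite le_min h0 lee_fin/=.
Qed.

Let k0 M x y : (0 <= k M x y)%R.
Proof. by rewrite -lee_fin kE le_min h0 lee_fin/=. Qed.

Let kM M x y : (k M x y <= M%:R)%R.
Proof. by rewrite -lee_fin kE ge_min lexx orbT. Qed.

Let kh M x y : (k M x y)%:E <= h x y.
Proof. by rewrite kE ge_min lexx. Qed.

Let mkE M : measurable_fun setT (fun z : T * T => (k M z.1 z.2)%:E).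
Proof.
under eq_fun do rewrite kE.
by apply: measurable_mine.
Qed.

Let mk M : measurable_fun setT (fun z : T * T => k M z.1 z.2).
Proof. apply/measurable_EFinP; exact: mkE. Qed.

(* Where h is infinite, so is r M: the difference is total since k M is
   finite. *)
Let r M x y : \bar R := h x y - (k M x y)%:E.

Let r0 M x y : 0 <= r M x y.
Proof. by rewrite sube_ge0// kh. Qed.

Let mr M : measurable_fun setT (fun z : T * T => r M z.1 z.2).
Proof. exact: emeasurable_funB. Qed.

Let hE M : h = fun x y => (k M x y)%:E + r M x y.
Proof.
by apply/funext => x; apply/funext => y; rewrite /r addeC subeK.
Qed.

Let e := energy mu h.
Let eM M := energy mu (fun x y => (k M x y)%:E).

Let e0 : 0 <= e.
Proof. by apply: integral_ge0 => x _; apply: integral_ge0. Qed.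

Let eE M : e = eM M + energy mu (r M).
Proof.
rewrite /e /eM !energy_prod//; last by move=> x y; rewrite lee_fin.
rewrite -ge0_integralD//; last by move=> z _; rewrite lee_fin.
by rewrite {1}(hE M).
Qed.

Let eM_le M : eM M <= e.
Proof.
by rewrite (eE M) leeDl//; apply: integral_ge0 => x _; apply: integral_ge0.
Qed.

Let eM0 M : 0 <= eM M.
Proof.
by apply: integral_ge0 => x _; apply: integral_ge0 => y _; rewrite lee_fin.
Qed.

Let k_cvg x y : (k M x y)%:E @[M --> \oo] --> h x y.
Proof.
under eq_fun do rewrite kE.
have := h0 x y; case: (h x y) => [a| |] // a0.
- apply: cvg_near_cst; apply: filterS (nbhs_infty_ger a) => M aM.
  by rewrite min_l// lee_fin.
- under eq_fun do rewrite min_r ?leey//.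
  by apply/cvgeryP; exact: cvgr_idn.
Qed.

Let eM_cvg : eM M @[M --> \oo] --> e.
Proof.
have eM_prod M : eM M = \int[mu \x mu]_z (k M z.1 z.2)%:E.
  by rewrite /eM energy_prod// => x y; rewrite lee_fin.
rewrite (funext eM_prod) /e energy_prod//.
have -> : \int[mu \x mu]_z h z.1 z.2 =
    \int[mu \x mu]_z limn (fun M => (k M z.1 z.2)%:E).
  by apply: eq_integral => z _; apply/esym/cvg_lim => //; exact: k_cvg.
apply: cvg_monotone_convergence => //.
- by move=> M z _; rewrite lee_fin.
- move=> z _ M N MN; rewrite !kE le_min ge_min lexx/= ge_min lee_fin ler_nat MN.
  by rewrite orbT.
Qed.

Let bounded_part : {ae P, forall w, forall M,
  ustat (fun x y => (k M x y)%:E) n (X^~ w) @[n --> \oo] --> eM M}.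
Proof. by apply: ae_foralln => M; exact: strong_law_bounded. Qed.

(* The exceptional set is contained, for every M, in an event of probability at
   most I(r_M) / l, and I(r_M) = I(h) - I(k_M) tends to 0. *)
Let remainder_part (l : R) : (0 < l)%R -> e < +oo ->
  {ae P, forall w, exists M, forall n, ustat (r M) n (X^~ w) <= l%:E}.
Proof.
move=> l0 eoo.
pose A M := [set w | exists n, l%:E < ustat (r M) n (X^~ w)].
have mA M : measurable (A M).
  rewrite (_ : A M = \bigcup_n [set w | l%:E < ustat (r M) n (X^~ w)]).
    apply: bigcup_measurable => n _; rewrite -[X in measurable X]setTI.
    by apply: emeasurable_fun_o_infty => //; apply: measurable_ustat => // i;
      exact: measurable_funP.
  by apply/seteqP; split => [w [n ln]|w [n _ ln]]; exists n.
have efin : e \is a fin_num by rewrite ge0_fin_numE.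
have eMfin M : eM M \is a fin_num.
  by rewrite ge0_fin_numE// (le_lt_trans (eM_le M)).
have erE M : energy mu (r M) = e - eM M by rewrite (eE M) [eM M + _]addeC addeK.
exists (\bigcap_M A M); split.
- exact: bigcap_measurableType.
- apply/eqP; rewrite -measure_le0.
  have cv : (l^-1)%:E * (e - eM M) @[M --> \oo] --> (l^-1)%:E * (e - e).
    apply: cvgeZl => //; apply: cvgeB => //; last exact: cvg_cst.
    by rewrite fin_num_adde_defr.
  rewrite subee// mule0 in cv.
  rewrite -(cvg_lim _ cv)//; apply: lime_ge.
    by apply/cvg_ex; eexists; exact: cv.
  apply: nearW => M; rewrite -erE.
  apply: le_trans (ustat_maximal (mr M) (r0 M) X_iid l0).
  apply: le_measure; rewrite ?inE.
  + exact: bigcap_measurableType.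
  + exact: (mA M).
  + by move=> w; exact.
- move=> w /= /forallNP noM M _; have /existsNP[n /negP] := noM M.
  by rewrite -ltNge => ln; exists n.
Qed.

Let le_ustat M n x : ustat (fun x y => (k M x y)%:E) n x <= ustat h n x.
Proof.
rewrite (hE M) ustatD//; first by rewrite leeDl// ustat_ge0.
by move=> a b; rewrite lee_fin.
Qed.

(** The lower bound [lo] comes from the bounded parts alone and covers the case
    of infinite energy; the upper bound [up] also uses the remainder. *)
Lemma strong_law_ustat :
  {ae P, forall w, ustat h n (X^~ w) @[n --> \oo] --> energy mu h}.
Proof.
have rem : {ae P, forall w, forall p, e < +oo ->
   exists M, forall n, ustat (r M) n (X^~ w) <= p.+1%:R^-1%:E}.
  apply: ae_foralln => p; have [eoo|noo] := pselect (e < +oo).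
    by apply: filterS (@remainder_part p.+1%:R^-1 _ eoo) => // w rw _.
  exact: aeW.
apply: filterS2 bounded_part rem => w bw rw.
set u := fun n => ustat h n (X^~ w).
have nbhs_gt (x y : \bar R) : x < y -> nbhs y [set z | x < z].
  move=> xy; apply: open_nbhs_nbhs; split; last exact: xy.
  exact: open_ereal_gt_ereal.
have nbhs_lt (x y : \bar R) : y < x -> nbhs y [set z | z < x].
  move=> xy; apply: open_nbhs_nbhs; split; last exact: xy.
  exact: open_ereal_lt_ereal.
have lo A : A%:E < e -> \forall n \near \oo, A%:E < u n.
  move=> Ae.
  have [M AM] : exists M, A%:E < eM M.
    have /= := eM_cvg (nbhs_gt _ _ Ae).
    by move=> [M _ HM]; exists M; exact: (HM M (leqnn M)).
  have kA : \forall n \near \oo,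
      A%:E < ustat (fun x y => (k M x y)%:E) n (X^~ w).
    exact: (bw M _ (nbhs_gt _ _ AM)).
  by apply: filterS kA => n /lt_le_trans; apply; exact: le_ustat.
have up B : e < B%:E -> \forall n \near \oo, u n < B%:E.
  move=> eB; have eoo : e < +oo by rewrite (lt_trans eB)// ltry.
  have efin : e \is a fin_num by rewrite ge0_fin_numE.
  have d0 : (0 < B - fine e)%R by rewrite subr_gt0 -lte_fin fineK.
  have [p pd] : exists p, (p.+1%:R^-1 < B - fine e)%R.
    by have [p] := ltr_add_invr d0; rewrite add0r; exists p.
  have [M Mr] := rw p eoo.
  have eMB : eM M < (B - p.+1%:R^-1)%:E.
    apply: (le_lt_trans (eM_le M)); rewrite -[ltLHS](fineK efin) lte_fin.
    by rewrite ltrBrDr -ltrBrDl.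
  have kB : \forall n \near \oo,
      ustat (fun x y => (k M x y)%:E) n (X^~ w) < (B - p.+1%:R^-1)%:E.
    exact: (bw M _ (nbhs_lt _ _ eMB)).
  apply: filterS kB => n kBn; rewrite /u (hE M) ustatD//; last first.
    by move=> a b; rewrite lee_fin.
  rewrite (_ : B%:E = (B - p.+1%:R^-1)%:E + p.+1%:R^-1%:E).
    apply: lte_leD => //.
    by rewrite ge0_fin_numE ?ustat_ge0// (le_lt_trans (Mr n)) ?ltry.
  by rewrite -EFinD subrK.
have [eoo|] := ltP e +oo; last first.
  rewrite leye_eq => /eqP ee; rewrite -/e ee; apply/cvgeyPgt => A.
  by apply: lo; rewrite ee ltry.
have efin : e \is a fin_num by rewrite ge0_fin_numE.
rewrite -/e -(fineK efin); apply/fine_cvgP; split.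
  have := up (fine e + 1)%R.
  rewrite -[X in X < _](fineK efin) lte_fin ltrDl ltr01.
  move=> /(_ isT); apply: filterS => n un.
  rewrite ge0_fin_numE ?ustat_ge0//; exact: lt_trans un (ltry _).
apply/cvgrPdist_lt => d d0.
have lo' : \forall n \near \oo, (fine e - d)%:E < u n.
  by apply: lo; rewrite -[X in _ < X](fineK efin) lte_fin; lra.
have up' : \forall n \near \oo, u n < (fine e + d)%:E.
  by apply: up; rewrite -[X in X < _](fineK efin) lte_fin; lra.
apply: filterS2 lo' up' => n ln nu.
have ufin : u n \is a fin_num.
  by rewrite ge0_fin_numE ?ustat_ge0//; exact: lt_trans nu (ltry _).
move: ln nu; rewrite -(fineK ufin) !lte_fin/= => ln nu.
by rewrite distrC ltr_distl; lra.
Qed.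

End strong_law.

(** * The Riesz kernel *)

Section riesz.
Context (R : realType) (d : nat).

Lemma measurable_coord (i : 'I_d) :
  measurable_fun setT (fun x : borelRd R d => x ord0 i).
Proof.
apply: (measurability _ (RGenOpens.measurableE R)).
move=> _ [_ [a [b ->] <-]]; apply: sub_sigma_algebra; rewrite setTI.
by apply: open_comp => [x _|]; [exact: coord_continuous|exact: interval_open].
Qed.

Lemma measurable_riesz_kernel (s : R) : measurable_fun setT
  (fun z : borelRd R d * borelRd R d => riesz_kernel s z.1 z.2).
Proof.
have mn : measurable_fun setT
    (fun z : borelRd R d * borelRd R d => enorm (z.1 - z.2)).
  apply: (measurableT_comp (f := @Num.sqrt R)).
    by apply: continuous_measurable_fun; exact: sqrt_continuous.
  apply: measurable_sum => i; apply: measurable_funX.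
  under eq_fun do rewrite !mxE.
  by apply: measurable_funB; apply: measurableT_comp (measurable_coord i) _.
rewrite /riesz_kernel; apply: measurable_fun_ifT => //.
- by apply: measurable_fun_eqr.
- apply/measurable_EFinP; exact: (measurableT_comp (measurable_powR _)).
Qed.

End riesz.

(* X n is the point written X_(n+1) when the sequence is numbered from 1. *)
Theorem theorem3p3 (R : realType) (d : nat) (d_ge1 : (1 <= d)%N)
    (s : R) (s_gt0 : 0 < s) (mu : probability (borelRd R d) R)
    (dO : measure_display) (Omega : measurableType dO)
    (P : probability Omega R) (X : nat -> {RV P >-> borelRd R d})
    (X_iid : iid_with_law X mu) :
  let U (n : nat) (w : Omega) : \bar R :=
    discrete_riesz_energy s (fun i : 'I_n => X i w) in
  ((riesz_energy s mu < +oo)%E ->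
    {ae P, forall w, U n w @[n --> \oo] --> riesz_energy s mu}) /\
  (riesz_energy s mu = +oo%E ->
    {ae P, forall w, U n w @[n --> \oo] --> (+oo%E : \bar R)}).
Proof.
move=> U.
have slln : {ae P, forall w, U n w @[n --> \oo] --> riesz_energy s mu}.
  have kernel_ge0 x y : (0 <= @riesz_kernel R d s x y)%E.
    by rewrite /riesz_kernel; case: ifP => // _; rewrite lee_fin powR_ge0.
  have H := strong_law_ustat (measurable_riesz_kernel s) kernel_ge0 X_iid.
  apply: filterS H => w; exact.
by split => [_ //|E]; rewrite -E.
Qed.
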